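(* For positive integers $m,n$, the fan graph $F_{m,n}$ is Schur positive if and only if \[ (m,n)\in\{(1,n)\colon n\in\{1,2,3,4\}\}\cup\{(2,n)\colon n\in\{1,\dots,6\}\}\cup\{(3,4)\}. \]
   Context: The fan graph $F_{m,n}$ is the join $\overline{K_m}+P_n$ of the edgeless graph on $m$ vertices and the path $P_n$ on $n$ vertices (every vertex of $\overline{K_m}$ is adjacent to every vertex of $P_n$). For a finite simple graph $G$, the chromatic symmetric function is $X_G=\sum_{\kappa}\prod_{v\in V(G)}x_{\kappa(v)}$ over proper colorings $\kappa:V(G)\to\{1,2,\dots\}$; $G$ is Schur positive if all coefficients of $X_G$ in the Schur basis are nonnegative. *)

(* Defs.v *)
From HB Require Import structures.
From mathcomp Require Import all_boot all_order all_algebra.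
From mathcomp Require Import mpoly.
Set Implicit Arguments. Unset Strict Implicit. Unset Printing Implicit Defensive.
Import GRing.Theory.
Local Open Scope ring_scope.

Definition proper_col (T : finType) (e : rel T) (N : nat) (k : {ffun T -> 'I_N}) : bool :=
  [forall x, forall y, e x y ==> (k x != k y)].

(* Chromatic symmetric function X_G, specialised to the N = |V(G)| variables
   x_1..x_N (i.e. x_i = 0 for i > N). *)
Definition chrom_sym (T : finType) (e : rel T) : {mpoly int[#|T|]} :=
  \sum_(k : {ffun T -> 'I_#|T|} | proper_col e k) \prod_(v : T) 'X_(k v).

(* Partitions of N, stored as weakly decreasing sequences of N parts
   lambda_0 >= ... >= lambda_{N-1} >= 0 (trailing zeros allowed) summing to N. *)
Definition is_part (N : nat) (l : {ffun 'I_N -> 'I_N.+1}) : bool :=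
  [forall i : 'I_N, forall j : 'I_N, (i <= j)%N ==> (l j <= l i)%N]
  && (\sum_(i < N) (l i : nat) == N)%N.

Definition in_shape (N : nat) (l : {ffun 'I_N -> 'I_N.+1}) (c : 'I_N * 'I_N) : bool :=
  (c.2 < l c.1)%N.

(* Semistandard Young tableaux of shape l with entries in 'I_N; entries
   outside the shape are normalised to 0 so that each SSYT is counted once. *)
Definition ssyt (N : nat) (l : {ffun 'I_N -> 'I_N.+1}) (t : {ffun 'I_N * 'I_N -> 'I_N}) : bool :=
  [&& [forall c, ~~ in_shape l c ==> (val (t c) == 0%N)],
      [forall c, forall d,
         [&& in_shape l c, in_shape l d, c.1 == d.1 & (c.2 <= d.2)%N] ==> (t c <= t d)%N]
    & [forall c, forall d,
         [&& in_shape l c, in_shape l d, c.2 == d.2 & (c.1 < d.1)%N] ==> (t c < t d)%N]].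

Definition schur (N : nat) (l : {ffun 'I_N -> 'I_N.+1}) : {mpoly int[N]} :=
  \sum_(t : {ffun 'I_N * 'I_N -> 'I_N} | ssyt l t) \prod_(c : 'I_N * 'I_N | in_shape l c) 'X_(t c).

(* G is Schur positive: X_G has nonnegative coefficients in the Schur basis.
   (Equivalent to the same statement in N = |V(G)| variables, since X_G is
   homogeneous of degree N and the s_l, l |- N, are linearly independent
   in N variables.) *)
Definition schur_positive (T : finType) (e : rel T) : Prop :=
  exists coef : {ffun 'I_#|T| -> 'I_#|T|.+1} -> nat,
    chrom_sym e = \sum_(l | is_part l) schur l *+ coef l.

(* Fan graph F_{m,n} = complement(K_m) + P_n on vertices 'I_m + 'I_n;
   the path P_n is 0 - 1 - ... - (n-1). *)

Definition fan_rel (m n : nat) : rel ('I_m + 'I_n)%type :=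
  fun x y => match x, y with
  | inl _, inr _ | inr _, inl _ => true
  | inr i, inr j => ((i : nat).+1 == j) || ((j : nat).+1 == i)
  | inl _, inl _ => false
  end.
Arguments fan_rel : clear implicits.

(* Main.v *)
Require Import Defs.
From HB Require Import structures.
From mathcomp Require Import all_boot all_order all_algebra.
From mathcomp Require Import fingroup perm mpoly zify.

(* Expanding a Schur function along the largest letter of its tableaux shows
   that its coefficient at a content s counts chains of horizontal strips with
   sizes s.  Such chains are symmetric in s (Bender-Knuth involution), and if a
   chain exists for the content (a, b, ...) with b < a, then one exists for
   (a - 1, b + 1, ...).  Hence, for a Schur positive graph, the contents of
   proper colourings are stable under such moves.  Let c and f be the numbers of
   even and odd positions of the path.  Starting from the colouring of F_{m,n} with
   content (m, c, f), one to three moves reach a content on at most four colours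
   which no proper colouring has, except for the pairs of the theorem and for
   (3,6), (4,6), (3,8).  For the last three a linear functional of the
   coefficients, nonnegative on Schur functions, is negative on X_G; the positive
   cases are verified from the explicit Schur expansions. *)

Set Implicit Arguments. Unset Strict Implicit. Unset Printing Implicit Defensive.
Import GRing.Theory Num.Theory.

(** * Horizontal strips, Kostka numbers and partitions as sequences *)

(** These are the [u] interlacing [l], i.e. those with [l/u] a horizontal strip. Zero parts are
    kept, so all shapes of a chain have the same length. *)
Fixpoint hstrips (l : seq nat) : seq (seq nat) :=
  if l is a :: l' then
    [seq b :: u | b <- iota (head 0 l') (a.+1 - head 0 l'), u <- hstrips l']
  else [:: [::]].

(** Strips are peeled off from the outside, so the head of [s] is the multiplicity of the largest
    letter. *)
Fixpoint kostka (l s : seq nat) : nat :=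
  if s is a :: s' then
    sumn [seq kostka u s' | u <- hstrips l & sumn u + a == sumn l]
  else sumn l == 0.

(** Exactly [k] entries, zeros included, to match the padded shapes of [is_part]. *)
Fixpoint parts (k mx n : nat) : seq (seq nat) :=
  if k is k'.+1 then
    [seq a :: u | a <- iota 0 (minn mx n).+1, u <- parts k' a (n - a)]
  else if n == 0 then [:: [::]] else [::].

Lemma hstripsP (l u : seq nat) :
  reflect (size u = size l /\ forall i, nth 0 l i.+1 <= nth 0 u i <= nth 0 l i)
          (u \in hstrips l).
Proof.
elim: l u => [|a l IH] u.
  rewrite inE; apply: (iffP eqP) => [->|[/eqP/nilP]//].
  by split=> // i; rewrite !nth_nil.
apply: (iffP allpairsPdep) => [[b [v [hb /IH[sv hv] ->]]]|].
  split=> [/=|[|i] /=]; [by rewrite sv| |exact: hv].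
  by move: hb; rewrite nth0 mem_iota; lia.
case: u => [[]//|b u] [/= [su] hu]; exists b, u; split=> //.
  by have := hu 0; rewrite /= nth0 mem_iota; lia.
by apply/IH; split=> // i; apply: (hu i.+1).
Qed.

Lemma hstrips_uniq (l : seq nat) : uniq (hstrips l).
Proof.
elim: l => //= a l IH; apply: allpairs_uniq; rewrite ?iota_uniq //.
by move=> [x1 x2] [y1 y2] _ _ /= [-> ->].
Qed.

Lemma partsP (k mx n : nat) (s : seq nat) :
  (s \in parts k mx n) = [&& size s == k, path geq mx s & sumn s == n].
Proof.
elim: k mx n s => [|k IH] mx n s.
  by rewrite /=; case: s => [|x s]; case: n.
case: s => [|x s].
  by apply/negbTE/allpairsPdep => -[? [? []]].
rewrite [RHS]/= eqSS; apply/allpairsPdep/idP => [[a [u [ha]]]|].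
  rewrite IH => /and3P[/eqP su pu /eqP nu] [-> ->].
  by move: ha; rewrite mem_iota su pu eqxx nu /=; lia.
case/and3P=> /eqP[ss] /andP[hx ps] /eqP sn; exists x, s; split=> //.
  by rewrite mem_iota; lia.
by rewrite IH ss eqxx ps /=; lia.
Qed.

Lemma parts_uniq (k mx n : nat) : uniq (parts k mx n).
Proof.
elim: k mx n => [|k IH] mx n; first by case: n.
apply: allpairs_uniq_dep => [|a _|]; [exact: iota_uniq|exact: IH|].
by move=> [x1 x2] [y1 y2] _ _ /= [-> ->].
Qed.

Lemma kostka_cons (l : seq nat) (a : nat) (s : seq nat) :
  kostka l (a :: s) = \sum_(u <- hstrips l | sumn u + a == sumn l) kostka u s.
Proof. by rewrite /= sumnE big_map big_filter. Qed.

Lemma kostka_sumn (l s : seq nat) : sumn s != sumn l -> kostka l s = 0.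
Proof.
elim: s l => [|a s IH] l; first by rewrite /= eq_sym => /negPf->.
move=> h; rewrite kostka_cons big1_seq // => u /andP[/eqP hu _].
by apply: IH; move: h => /=; lia.
Qed.

Lemma sumn_nth (s : seq nat) (k : nat) : size s <= k ->
  sumn s = \sum_(i < k) nth 0 s i.
Proof.
elim: s k => [|x s IH] k /=; first by rewrite big1 // => i; rewrite nth_nil.
by case: k => // k /IH->; rewrite big_ord_recl.
Qed.

(** * Two-step chains: symmetry of Kostka numbers and the balancing move *)

(* The middle partition of a two-step chain from l down to u varies in a
   product of intervals, the i-th one being [chain_lo l u i, chain_hi l u i]. *)
Definition chain_lo (l u : seq nat) (i : nat) := maxn (nth 0 l i.+1) (nth 0 u i).
Definition chain_hi (l u : seq nat) (i : nat) := minn (nth 0 l i) (nth 0 (head 0 l :: u) i).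

(** Interlacing bounds [v_i] below by [l_{i+1}] and [u_i], above by [l_i] and [u_{i-1}],
    independently for each [i]. At [i = 0] the head of [l] stands in for the missing [u_{-1}]. *)
Lemma chainP (l v u : seq nat) :
  (v \in hstrips l) && (u \in hstrips v) <->
  [/\ size v = size l, size u = size l &
      forall i, chain_lo l u i <= nth 0 v i <= chain_hi l u i].
Proof.
rewrite /chain_lo /chain_hi; split.
  case/andP=> /hstripsP[sv hv] /hstripsP[su hu]; split=> //; first by rewrite su.
  move=> [|i] /=; last by move: (hv i.+1) (hu i) (hu i.+1); lia.
  by rewrite -nth0; move: (hv 0) (hu 0); lia.
case=> sv su h; apply/andP; split; apply/hstripsP; split; rewrite ?su ?sv // => i.
  by have := h i; lia.
by move: (h i) (h i.+1); rewrite /=; lia.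
Qed.

(** The lower end at [i] and the upper end at [i + 1] are the maximum and minimum of the same pair
    [l_{i+1}], [u_i]. What remains is the first upper end [l_0] and the last lower end, the last
    entry of [u]. *)
Lemma chain_sum (l u : seq nat) (n : nat) : size l = n -> size u = n ->
  \sum_(i < n) (chain_lo l u i + chain_hi l u i) = sumn l + sumn u.
Proof.
case: n => [|n] sl su.
  by rewrite big_ord0 (size0nil sl) (size0nil su).
have -> : sumn l = nth 0 l 0 + \sum_(i < n) nth 0 l i.+1.
  by rewrite (sumn_nth (k := n.+1)) ?sl // big_ord_recl.
have -> : sumn u = \sum_(i < n) nth 0 u i + nth 0 u n.
  by rewrite (sumn_nth (k := n.+1)) ?su // big_ord_recr.
rewrite big_split big_ord_recr big_ord_recl /=.
rewrite {2}/chain_lo {1}/chain_hi /= -nth0 (nth_default 0 (n := n.+1)) ?sl //.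
have E : \sum_(i < n) chain_lo l u i + \sum_(i < n) chain_hi l u (bump 0 i) =
         \sum_(i < n) nth 0 l i.+1 + \sum_(i < n) nth 0 u i.
  rewrite -!big_split; apply: eq_bigr => i _ /=.
  by rewrite /chain_lo /chain_hi /bump leq0n add1n /=; lia.
by move: E; rewrite /= ; lia.
Qed.

Definition chains (l : seq nat) (a b : nat) : seq (seq nat * seq nat) :=
  [seq (v, u) | v <- [seq v <- hstrips l | sumn v + a == sumn l],
                u <- [seq u <- hstrips v | sumn u + b == sumn v]].

Lemma mem_chains (l : seq nat) (a b : nat) (v u : seq nat) :
  ((v, u) \in chains l a b) =
  [&& (v \in hstrips l) && (u \in hstrips v), sumn v + a == sumn l & sumn u + b == sumn v].
Proof.
apply/allpairsPdep/idP => [[v' [u' []]]|].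
  rewrite !mem_filter => /andP[h1 h2] /andP[h3 h4] [-> ->].
  by rewrite h1 h2 h3 h4.
case/and3P=> /andP[h1 h2] h3 h4; exists v, u.
by rewrite !mem_filter h1 h2 h3 h4.
Qed.

Lemma chains_uniq (l : seq nat) (a b : nat) : uniq (chains l a b).
Proof.
apply: allpairs_uniq_dep; first by rewrite filter_uniq ?hstrips_uniq.
  by move=> v _; rewrite filter_uniq ?hstrips_uniq.
by move=> [x1 x2] [y1 y2] _ _ /= [-> ->].
Qed.

Lemma kostka_cons2 (l : seq nat) (a b : nat) (s : seq nat) :
  kostka l (a :: b :: s) = \sum_(p <- chains l a b) kostka p.2 s.
Proof.
rewrite big_allpairs_dep big_filter kostka_cons; apply: eq_bigr => v _.
by rewrite big_filter kostka_cons.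
Qed.

(** The Bender-Knuth involution: each entry of the middle partition is reflected in its interval. *)
Definition chain_flip (l : seq nat) (p : seq nat * seq nat) : seq nat * seq nat :=
  (mkseq (fun i => chain_lo l p.2 i + chain_hi l p.2 i - nth 0 p.1 i) (size l), p.2).

(** By [chain_sum] the reflected middle partition has size [|l| + |u| - |v|], so the two strip sizes
    are exchanged. *)
Lemma chain_flip_mem (l : seq nat) (a b : nat) (p : seq nat * seq nat) :
  p \in chains l a b ->
  chain_flip l p \in chains l b a /\ chain_flip l (chain_flip l p) = p.
Proof.
case: p => v u; rewrite mem_chains => /and3P[/chainP[sv su h] /eqP hv /eqP hu].
set w := mkseq (fun i => chain_lo l u i + chain_hi l u i - nth 0 v i) (size l).
have sw : size w = size l by rewrite size_mkseq.
have nw i : i < size l -> nth 0 w i = chain_lo l u i + chain_hi l u i - nth 0 v i.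
  by move=> hi; rewrite nth_mkseq.
have sumw : sumn w + sumn v = sumn l + sumn u.
  rewrite -(chain_sum erefl su) (sumn_nth (k := size l)) ?sw //.
  rewrite (sumn_nth (s := v) (k := size l)) ?sv // -big_split; apply: eq_bigr => i _ /=.
  by rewrite nw //; have := h i; lia.
split; last first.
  rewrite /chain_flip /= -/w; congr pair.
  apply: (@eq_from_nth _ 0) => [|i]; rewrite size_mkseq ?sv // => hi.
  by rewrite nth_mkseq // nw //; have := h i; lia.
rewrite /chain_flip /= -/w mem_chains; apply/and3P; split; try lia.
apply/chainP; split=> // i; have := h i.
case: (ltnP i (size l)) => hi; first by rewrite nw //; lia.
by rewrite !(nth_default 0 (n := i)) ?sv ?sw.
Qed.

Lemma kostka_swap (l : seq nat) (a b : nat) (s : seq nat) :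
  kostka l (a :: b :: s) = kostka l (b :: a :: s).
Proof.
rewrite !kostka_cons2.
transitivity (\sum_(p <- map (chain_flip l) (chains l a b)) kostka p.2 s).
  by rewrite big_map.
apply/perm_big/uniq_perm; rewrite ?chains_uniq ?map_inj_in_uniq ?chains_uniq //.
  move=> p q /chain_flip_mem[_ hp] /chain_flip_mem[_ hq] E.
  by rewrite -hp -hq E.
move=> p; apply/mapP/idP => [[q /chain_flip_mem[hq _] ->]//|].
by case/chain_flip_mem=> hp Ep; exists (chain_flip l p).
Qed.

(** Adjacent swaps suffice: the head of [s] is carried to the front of [t] one letter at a time. *)
Lemma kostka_perm (l s t : seq nat) : perm_eq s t -> kostka l s = kostka l t.
Proof.
elim: s l t => [|a s IH] l t; first by rewrite perm_sym => /perm_nilP->.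
move=> hst; have /splitPr : a \in t by rewrite -(perm_mem hst) mem_head.
move: hst => /[swap] -[t1 t2].
rewrite perm_sym (perm_catCA _ [:: a]) perm_cons perm_sym => hst.
transitivity (kostka l (a :: t1 ++ t2)).
  by rewrite !kostka_cons; apply: eq_bigr => u _; apply: IH.
elim: t1 l {s IH hst} => // b t1 IH l; rewrite cat_cons.
by rewrite [LHS]kostka_swap !(kostka_cons _ b); apply: eq_bigr => u _; apply: IH.
Qed.

(** If every [v_i] were at the upper end of its interval, [chain_sum] would give
    [|l| + |u| <= 2|v|], i.e. [a <= b]. So some entry of [v] can be raised by one, which transfers a
    cell from the first strip to the second. *)
Lemma kostka_move (l : seq nat) (a b : nat) (s : seq nat) : b < a ->
  0 < kostka l (a :: b :: s) -> 0 < kostka l (a.-1 :: b.+1 :: s).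
Proof.
move=> ltba; rewrite !kostka_cons2 !lt0n !sum_nat_seq_neq0.
case/hasP=> -[v u]; rewrite mem_chains => /and3P[/chainP[sv su h] /eqP hv /eqP hu] /= hK.
have [/existsP[i hi]|/existsPn hn] :=
    boolP [exists i : 'I_(size l), nth 0 v i < chain_hi l u i]; last first.
  have : sumn l + sumn u <= sumn v + sumn v.
    rewrite -(chain_sum erefl su) (sumn_nth (s := v) (k := size l)) ?sv //.
    rewrite -big_split leq_sum // => i _.
    by move: (h i) (hn i) => /=; lia.
  lia.
apply/hasP; exists (set_nth 0 v i (nth 0 v i).+1, u); rewrite // mem_chains.
have sumE : sumn (set_nth 0 v i (nth 0 v i).+1) = (sumn v).+1.
  by rewrite sumn_set_nth_ltn ?sv // addnS subSn ?leq_addl // addnK.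
apply/and3P; split; try lia.
apply/chainP; split=> // [|j].
  by rewrite size_set_nth sv; apply/maxn_idPr.
rewrite nth_set_nth /=; case: eqP => [->|_]; last exact: h.
by have := h i; lia.
Qed.

(** * Shapes as finite functions and as sequences *)

Definition shape_seq (N : nat) (l : {ffun 'I_N -> 'I_N.+1}) : seq nat :=
  [seq (l i : nat) | i <- enum 'I_N].

Definition seq_shape (N : nat) (u : seq nat) : {ffun 'I_N -> 'I_N.+1} :=
  [ffun i : 'I_N => inord (nth 0 u i)].

Lemma size_shape_seq (N : nat) (l : {ffun 'I_N -> 'I_N.+1}) : size (shape_seq l) = N.
Proof. by rewrite size_map size_enum_ord. Qed.

Lemma nth_shape_seq (N : nat) (l : {ffun 'I_N -> 'I_N.+1}) (i : 'I_N) :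
  nth 0 (shape_seq l) i = l i.
Proof. by rewrite (nth_map i) ?size_enum_ord // nth_ord_enum. Qed.

Lemma shape_seqK (N : nat) : cancel (@shape_seq N) (@seq_shape N).
Proof. by move=> l; apply/ffunP=> i; rewrite ffunE nth_shape_seq inord_val. Qed.

Lemma seq_shapeK (N : nat) (u : seq nat) : size u = N -> (forall i, nth 0 u i <= N) ->
  shape_seq (seq_shape N u) = u.
Proof.
move=> su hu; apply: (@eq_from_nth _ 0); rewrite size_shape_seq // => i hi.
by rewrite (nth_shape_seq _ (Ordinal hi)) ffunE inordK // ltnS.
Qed.

Lemma sumn_shape_seq (N : nat) (l : {ffun 'I_N -> 'I_N.+1}) :
  sumn (shape_seq l) = \sum_(i < N) l i.
Proof. by rewrite sumnE big_map big_enum. Qed.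

(** The bridge from sums over finite functions, as in the definitions, to computable sums over
    lists. *)
Lemma big_shape_seq (R : Type) (idx : R) (op : Monoid.com_law idx) (N : nat)
    (P : pred (seq nat)) (S : seq (seq nat)) (F : seq nat -> R) :
  uniq S -> (forall u, u \in S -> P u -> size u = N /\ forall i, nth 0 u i <= N) ->
  \big[op/idx]_(l : {ffun 'I_N -> 'I_N.+1} | (shape_seq l \in S) && P (shape_seq l))
     F (shape_seq l) = \big[op/idx]_(u <- S | P u) F u.
Proof.
move=> uS hS; rewrite -[LHS]big_filter -[RHS]big_filter.
rewrite -(big_map (@shape_seq N) predT F); apply/perm_big/uniq_perm.
- rewrite map_inj_uniq ?filter_uniq ?index_enum_uniq //.
  exact: (can_inj (@shape_seqK N)).
- exact: filter_uniq.
move=> u; rewrite mem_filter; apply/mapP/andP => [[l]|[Pu uS']].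
  by rewrite mem_filter => /andP[/andP[h1 h2] _] ->.
have [su hu] := hS _ uS' Pu.
by exists (seq_shape N u); rewrite ?mem_filter ?mem_index_enum seq_shapeK // uS' Pu.
Qed.

(** * Counting semistandard tableaux by Kostka numbers *)

Definition decreasing (N : nat) (l : {ffun 'I_N -> 'I_N.+1}) : Prop :=
  forall i j : 'I_N, i <= j -> l j <= l i.

Lemma ssytP (N : nat) (l : {ffun 'I_N -> 'I_N.+1}) (t : {ffun 'I_N * 'I_N -> 'I_N}) :
  reflect
    [/\ forall i j : 'I_N, l i <= j -> t (i, j) = 0 :> nat,
        forall i j j' : 'I_N, j' < l i -> j <= j' -> t (i, j) <= t (i, j') &
        forall i i' j : 'I_N, j < l i -> j < l i' -> i < i' -> t (i, j) < t (i', j)]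
    (ssyt l t).
Proof.
rewrite /ssyt /in_shape; apply: (iffP and3P) => -[h1 h2 h3]; split.
- move=> i j hj; apply/eqP; move/forallP/(_ (i, j))/implyP: h1; apply.
  by rewrite /= -leqNgt.
- move=> i j j' hj' hj; move/forallP/(_ (i, j))/forallP/(_ (i, j'))/implyP: h2.
  by apply; rewrite /= eqxx hj hj' (leq_ltn_trans hj).
- move=> i i' j hi hi' lt; move/forallP/(_ (i, j))/forallP/(_ (i', j))/implyP: h3.
  by apply; rewrite /= eqxx hi hi' lt.
- by apply/forallP=> -[i j]; apply/implyP; rewrite /= -leqNgt => /h1->.
- apply/forallP=> -[i j]; apply/forallP=> -[i' j']; apply/implyP=> /=.
  by case/and4P=> _ hj' /eqP E; move: hj'; rewrite -E; apply: h2.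
- apply/forallP=> -[i j]; apply/forallP=> -[i' j']; apply/implyP=> /=.
  by case/and4P=> hj hj' /eqP E; move: hj'; rewrite -E; apply: h3.
Qed.

Lemma card_ltn_ord (N k : nat) : k <= N -> #|[set j : 'I_N | j < k]| = k.
Proof.
move=> hk; rewrite cardsE -sum1_card (eq_bigl (fun j : 'I_N => j < k)) //.
by rewrite -(big_ord_widen _ (fun=> 1)) // sum1_card card_ord.
Qed.

Lemma down_closed_card (N : nat) (A : {set 'I_N}) :
  (forall i j : 'I_N, i <= j -> j \in A -> i \in A) ->
  forall j, (j \in A) = (j < #|A|).
Proof.
move=> hA j; apply/idP/idP => [jA|].
  rewrite -{1}(card_ltn_ord (ltn_ord j)); apply/subset_leq_card/subsetP => i.
  by rewrite inE ltnS => /hA; apply.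
rewrite ltnNge; apply: contraR => jA; rewrite -[leqRHS](card_ltn_ord (ltnW (ltn_ord j))).
apply/subset_leq_card/subsetP => i iA; rewrite inE ltnNge.
by apply: contra jA => /hA; apply.
Qed.

Lemma card_set_bij (T1 T2 : finType) (A : {set T1}) (B : {set T2})
    (f : T1 -> T2) (g : T2 -> T1) :
  (forall x, x \in A -> f x \in B /\ g (f x) = x) ->
  (forall y, y \in B -> g y \in A /\ f (g y) = y) -> #|A| = #|B|.
Proof.
move=> hA hB; rewrite -(card_in_imset (f := f) (D := A)); last first.
  by move=> x y /hA[_ hx] /hA[_ hy] E; rewrite -hx -hy E.
congr #|pred_of_set _|; apply/setP=> y; apply/imsetP/idP => [[x /hA[hx _] ->]//|].
by case/hB=> hy E; exists (g y).
Qed.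

Lemma card_in_shape (N : nat) (l : {ffun 'I_N -> 'I_N.+1}) :
  #|[set c | in_shape l c]| = sumn (shape_seq l).
Proof.
rewrite sumn_shape_seq cardsE -sum1_card.
rewrite (eq_bigl (fun c : 'I_N * 'I_N => true && (c.2 < l c.1))) //.
rewrite -(pair_big_dep (fun=> true) (fun i j : 'I_N => j < l i) (fun _ _ => 1)) /=.
apply: eq_bigr => i _; rewrite sum1_card -[RHS](@card_ltn_ord N (l i)) ?cardsE //.
by rewrite -ltnS.
Qed.

Definition tableaux (N : nat) (l : {ffun 'I_N -> 'I_N.+1}) (k : nat) (s : seq nat) :=
  [set t | [&& ssyt l t, [forall c, in_shape l c ==> (t c < k)] &
    [forall i : 'I_N, (i < k) ==> (#|[set c | in_shape l c && (t c == i)]| == nth 0 s i)]]].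

Lemma tableauxP (N : nat) (l : {ffun 'I_N -> 'I_N.+1}) (k : nat) (s : seq nat)
    (t : {ffun 'I_N * 'I_N -> 'I_N}) :
  reflect
    [/\ ssyt l t, forall i j : 'I_N, j < l i -> t (i, j) < k &
        forall i : 'I_N, i < k -> #|[set c | in_shape l c && (t c == i)]| = nth 0 s i]
    (t \in tableaux l k s).
Proof.
rewrite inE; apply: (iffP and3P) => -[h1 h2 h3]; split=> //.
- by move=> i j; apply/implyP; apply: (forallP h2 (i, j)).
- by move=> i ik; apply/eqP; move/forallP/(_ i)/implyP: h3; apply.
- by apply/forallP=> -[i j]; apply/implyP/h2.
- by apply/forallP=> i; apply/implyP=> /h3->.
Qed.

Definition small_shape (N : nat) (l : {ffun 'I_N -> 'I_N.+1}) (k : nat)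
    (t : {ffun 'I_N * 'I_N -> 'I_N}) : {ffun 'I_N -> 'I_N.+1} :=
  [ffun i => inord #|[set j : 'I_N | (j < l i) && (t (i, j) < k)]|].

Lemma small_shapeE (N : nat) (l : {ffun 'I_N -> 'I_N.+1}) (k : nat)
    (t : {ffun 'I_N * 'I_N -> 'I_N}) (i j : 'I_N) : ssyt l t ->
  (j < small_shape l k t i) = (j < l i) && (t (i, j) < k).
Proof.
case/ssytP=> _ hr _; rewrite ffunE inordK; last first.
  by rewrite ltnS -[X in _ <= X](card_ord N) max_card.
rewrite -down_closed_card ?inE // => j1 j2 h; rewrite !inE => /andP[h1 h2].
by rewrite (leq_ltn_trans h h1) (leq_ltn_trans (hr _ _ _ h1 h)).
Qed.

(** The removed cells all contain [k], and a strictly increasing column has at most one such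
    cell. *)
Lemma small_shape_hstrip (N : nat) (l : {ffun 'I_N -> 'I_N.+1}) (k : nat)
    (t : {ffun 'I_N * 'I_N -> 'I_N}) : decreasing l -> ssyt l t ->
  (forall i j : 'I_N, j < l i -> t (i, j) < k.+1) ->
  shape_seq (small_shape l k t) \in hstrips (shape_seq l).
Proof.
move=> dl ht hk; have [_ hr hc] := ssytP _ _ ht.
apply/hstripsP; rewrite !size_shape_seq; split=> // i.
case: (ltnP i N) => hi; last by rewrite !nth_default ?size_shape_seq // (leq_trans hi).
rewrite !(nth_shape_seq _ (Ordinal hi)); apply/andP; split; last first.
  case E: (small_shape l k t (Ordinal hi) : nat) => [//|p].
  have hp : p < N by rewrite -ltnS -E.
  have := small_shapeE k (Ordinal hi) (Ordinal hp) ht.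
  by rewrite E /= ltnSn => /esym/andP[].
case: (ltnP i.+1 N) => hi1; last by rewrite nth_default ?size_shape_seq.
rewrite (nth_shape_seq _ (Ordinal hi1)).
case E: (l (Ordinal hi1) : nat) => [//|p].
have hp : p < N by rewrite -ltnS -E.
have dp : p < l (Ordinal hi) by rewrite -E; apply: dl => /=.
rewrite (small_shapeE k (Ordinal hi) (Ordinal hp) ht) dp /=.
have /hk : Ordinal hp < l (Ordinal hi1) by rewrite E.
by rewrite ltnS; apply: leq_trans; apply: hc => //; rewrite E.
Qed.

Lemma hstrip_shape (N : nat) (l u : {ffun 'I_N -> 'I_N.+1}) :
  decreasing l -> shape_seq u \in hstrips (shape_seq l) ->
  (forall i, u i <= l i) /\ (forall i j : 'I_N, i < j -> l j <= u i).
Proof.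
move=> dl /hstripsP[_ h]; split=> [i|i j ltij].
  by have /andP[_] := h i; rewrite !nth_shape_seq.
have hi1 : i.+1 < N := leq_ltn_trans ltij (ltn_ord j).
have /andP[+ _] := h i; rewrite nth_shape_seq (nth_shape_seq _ (Ordinal hi1)).
by apply: leq_trans; apply: dl.
Qed.

Lemma decreasing_hstrip (N : nat) (l u : {ffun 'I_N -> 'I_N.+1}) :
  decreasing l -> shape_seq u \in hstrips (shape_seq l) -> decreasing u.
Proof.
move=> dl /(hstrip_shape dl)[h1 h2] i j; rewrite leq_eqVlt => /predU1P[/val_inj->//|lt].
exact: leq_trans (h1 j) (h2 _ _ lt).
Qed.

(* Erasing the letter k turns a tableau with letters 0, ..., k into a tableau
   with letters 0, ..., k - 1; the erased cells form a horizontal strip. *)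
Lemma card_tableaux_rcons (N : nat) (l u : {ffun 'I_N -> 'I_N.+1}) (s : seq nat) (a : nat) :
  decreasing l -> size s < N -> shape_seq u \in hstrips (shape_seq l) ->
  sumn (shape_seq u) + a = sumn (shape_seq l) ->
  #|[set t in tableaux l (size s).+1 (rcons s a) | small_shape l (size s) t == u]| =
  #|tableaux u (size s) s|.
Proof.
move=> dl ltsN hul sul; have [leul ltlu] := hstrip_shape dl hul.
have du := decreasing_hstrip dl hul.
set k := size s in ltsN *; pose z : 'I_N := Ordinal (leq_ltn_trans (leq0n k) ltsN).
(* [f] erases the letter [k], resetting cells outside [u] to the normalised value 0; [g] writes [k]
   back on [l/u]. *)
pose f (t : {ffun 'I_N * 'I_N -> 'I_N}) :=
  [ffun c => if in_shape u c then t c else z] : {ffun 'I_N * 'I_N -> 'I_N}.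
pose g (t : {ffun 'I_N * 'I_N -> 'I_N}) :=
  [ffun c => if in_shape u c then t c else if in_shape l c then Ordinal ltsN else z]
  : {ffun 'I_N * 'I_N -> 'I_N}.
have sub c : in_shape u c -> in_shape l c by move/leq_trans; apply.
have fE t i j : f t (i, j) = if j < u i then t (i, j) else z by rewrite ffunE.
have gE t i j : g t (i, j) =
    if j < u i then t (i, j) else if j < l i then Ordinal ltsN else z.
  by rewrite ffunE.
apply: (card_set_bij (f := f) (g := g)) => t.
  rewrite inE => /andP[/tableauxP[ht hk hc] /eqP tu].
  have inu (i j : 'I_N) : (j < u i) = (j < l i) && (t (i, j) < k).
    by rewrite -tu small_shapeE.
  have [h0 hr hcol] := ssytP _ _ ht; split; last first.
    apply/ffunP=> -[i j]; rewrite gE fE inu.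
    case: (ltnP j (l i)) => //= [hj|/h0 h]; last exact/val_inj.
    case: ltnP => // h; apply/val_inj/eqP; rewrite /= eqn_leq h.
    by rewrite -ltnS hk.
  apply/tableauxP; split.
  - apply/ssytP; split=> [i j hj|i j j' hj' hj|i i' j hj hj' lt].
    + by rewrite fE ltnNge hj.
    + rewrite !fE hj' (leq_ltn_trans hj hj'); apply: hr hj.
      by move: hj'; rewrite inu => /andP[].
    rewrite !fE hj hj'; apply: hcol lt; first by move: hj; rewrite inu => /andP[].
    by move: hj'; rewrite inu => /andP[].
  - by move=> i j hj; rewrite fE hj; move: hj; rewrite inu => /andP[].
  move=> i ik; have <- : nth 0 (rcons s a) i = nth 0 s i by rewrite nth_rcons ik.
  rewrite -hc ?ltnS 1?ltnW //.
  apply: eq_card => -[i' j']; rewrite !inE /in_shape /= fE.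
  case hu: (j' < u i') => /=; first by have := sub (i', j') hu; rewrite /in_shape /= => ->.
  apply/esym/negP=> /andP[hl /eqP E]; move: hu; rewrite inu hl E.
  by rewrite ik.
case/tableauxP=> ht hk hc; have [h0 hr hcol] := ssytP _ _ ht.
have gk (i j : 'I_N) : j < l i -> (g t (i, j) < k) = (j < u i).
  move=> hl; rewrite gE hl; case: ifP => [/hk->//|_] /=.
  by rewrite ltnn.
have tg : ssyt l (g t).
  apply/ssytP; split=> [i j hj|i j j' hj' hj|i i' j hj hj' lt].
  - by rewrite gE !ltnNge hj (leq_trans (leul i) hj).
  - rewrite !gE hj' (leq_ltn_trans hj hj'); case: (ltnP j' (u i)) => hju.
      by rewrite (leq_ltn_trans hj hju) hr.
    by case: ifP => // /hk /ltnW.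
  rewrite !gE hj hj' (leq_trans hj' (ltlu _ _ lt)); case: (ltnP j (u i')) => hju.
    by apply: hcol => //; apply: leq_trans hj' (ltlu _ _ lt).
  by apply: hk; apply: leq_trans hj' (ltlu _ _ lt).
have gu : small_shape l k (g t) = u.
  apply/ffunP=> i; apply/val_inj/eqP; rewrite /= eqn_leq; apply/andP; split.
    case E: (small_shape l k (g t) i : nat) => [//|p].
    have hp : p < N by rewrite -ltnS -E.
    have := small_shapeE k i (Ordinal hp) tg; rewrite E /= ltnSn => /esym/andP[hl].
    by rewrite gk.
  case E: (u i : nat) => [//|p].
  have hp : p < N by rewrite -ltnS -E.
  rewrite -[p]/(val (Ordinal hp)) small_shapeE //.
  have hl : Ordinal hp < l i by apply: leq_trans (leul i); rewrite /= E.
  by rewrite gk //= E leqnn andbT.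
split; last first.
  apply/ffunP=> -[i j]; rewrite fE gE; case: ltnP => // /h0 h; exact/val_inj.
rewrite inE gu eqxx andbT; apply/tableauxP; split=> // [i j hj|i].
  by rewrite gE hj; case: ifP => [/hk /ltnW|_] //=.
rewrite ltnS leq_eqVlt => /predU1P[ik|ik].
  (* The cells holding the last letter are those of [l/u], and there are [|l| - |u| = a] of them. *)
  rewrite ik nth_rcons ltnn eqxx; apply/eqP.
  rewrite -(eqn_add2l (sumn (shape_seq u))) sul -!card_in_shape.
  rewrite -cardsUI [X in _ + X](_ : _ = 0) ?addn0.
    apply/eqP/eq_card => -[i' j']; rewrite !inE.
    case hu: (in_shape u (i', j')) => /=; first by rewrite sub.
    case hl: (in_shape l (i', j')) => //=.
    rewrite gE; move: hu hl; rewrite /in_shape /= => -> ->.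
    by rewrite -val_eqE /= ik eqxx.
  apply/eqP; rewrite cards_eq0; apply/eqP/setP=> -[i' j']; rewrite !inE.
  apply/negP=> /and3P[hu hl /eqP E].
  by have := gk i' j' hl; rewrite E ik ltnn; move: hu; rewrite /in_shape /= => ->.
rewrite nth_rcons ik -hc //.
apply: eq_card => -[i' j']; rewrite !inE /in_shape /= gE.
case hu: (j' < u i') => /=; first by have := sub (i', j') hu; rewrite /in_shape /= => ->.
case: ifP => //= _; apply/negP=> /eqP E.
by move: ik; rewrite -E /= ltnn.
Qed.

(** Induction on the number of letters, sorting the tableaux by the shape left after erasing the
    largest one. The content is reversed because [kostka] consumes the largest letter first. *)
Lemma card_tableaux (N : nat) (l : {ffun 'I_N -> 'I_N.+1}) (s : seq nat) :
  0 < N -> decreasing l -> size s <= N ->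
  #|tableaux l (size s) s| = kostka (shape_seq l) (rev s).
Proof.
move=> N0; elim/last_ind: s l => [|s a IH] l dl.
  move=> _ /=; case: eqP => hl; last first.
    apply/eqP; rewrite cards_eq0; apply/eqP/setP=> t; rewrite in_set0.
    apply/negP=> /tableauxP[_ ht _]; case: hl.
    rewrite -card_in_shape; apply/eqP; rewrite cards_eq0; apply/eqP/setP=> -[i j].
    by rewrite !inE; apply/negP=> /ht.
  have out (i j : 'I_N) : l i <= j.
    rewrite leqNgt; apply/negP=> h; have := card_in_shape l.
    by rewrite hl => /eqP; rewrite cards_eq0 => /eqP/setP/(_ (i, j)); rewrite !inE /in_shape h.
  (* On the empty shape the normalisation leaves only the constant filling 0. *)
  apply/eqP/cards1P; exists [ffun=> Ordinal N0]; apply/setP=> t; rewrite in_set1.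
  apply/tableauxP/eqP => [[/ssytP[h _ _] _ _]|->].
    by apply/ffunP=> -[i j]; rewrite ffunE; apply/val_inj/h.
  split=> // [|i j]; last by rewrite ltnNge out.
  apply/ssytP; split=> [i j _|i j j'|i i' j]; first by rewrite ffunE.
    by rewrite ltnNge out.
  by rewrite ltnNge out.
rewrite size_rcons rev_rcons => ltsN.
rewrite kostka_cons -(@big_shape_seq _ _ _ N) ?hstrips_uniq //; last first.
  move=> u /hstripsP[-> h] _; rewrite size_shape_seq; split=> // i.
  have /andP[_ /leq_trans] := h i; apply.
  case: (ltnP i N) => hi; last by rewrite nth_default ?size_shape_seq.
  by rewrite (nth_shape_seq _ (Ordinal hi)) -ltnS.
rewrite -sum1_card (partition_big (small_shape l (size s))
  (fun u => (shape_seq u \in hstrips (shape_seq l)) &&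
            (sumn (shape_seq u) + a == sumn (shape_seq l)))) /=; last first.
  move=> t /tableauxP[ht hk hc]; rewrite small_shape_hstrip //=.
  have := hc (Ordinal ltsN) (ltnSn _); rewrite nth_rcons ltnn eqxx => <-.
  rewrite -!card_in_shape -cardsUI [X in _ + X](_ : _ = 0) ?addn0.
    apply/eqP/eq_card => -[i j]; rewrite !inE /in_shape /= small_shapeE //.
    case hl: (j < l i) => //=.
    by have := hk _ _ hl; rewrite ltnS leq_eqVlt orbC -val_eqE /= => ->.
  apply/eqP; rewrite cards_eq0; apply/eqP/setP=> -[i j]; rewrite !inE /in_shape /=.
  rewrite small_shapeE //; apply/negP=> /andP[/andP[_ h] /andP[_ /eqP E]].
  by move: h; rewrite E /= ltnn.
apply: eq_bigr => u /andP[hu /eqP su].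
rewrite sum1dep_card card_tableaux_rcons // IH //; first exact: decreasing_hstrip hu.
exact: ltnW.
Qed.

(** * Monomial coefficients of Schur and chromatic symmetric functions *)

Definition mnm_seq (N : nat) (a : 'X_{1..N}) : seq nat := [seq a i | i <- enum 'I_N].

Lemma size_mnm_seq (N : nat) (a : 'X_{1..N}) : size (mnm_seq a) = N.
Proof. by rewrite size_map size_enum_ord. Qed.

Lemma nth_mnm_seq (N : nat) (a : 'X_{1..N}) (i : 'I_N) : nth 0 (mnm_seq a) i = a i.
Proof. by rewrite (nth_map i) ?size_enum_ord // nth_ord_enum. Qed.

Lemma mcoeff_prodX (I : finType) (N : nat) (P : pred I) (f : I -> 'I_N) (a : 'X_{1..N}) :
  mcoeff a ((\prod_(i | P i) 'X_(f i))%R : {mpoly int[N]}) =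
  (([forall j, #|[set i | P i && (f i == j)]| == nth 0 (mnm_seq a) j] : nat)%:R)%R.
Proof.
rewrite mprodXE mcoeffX; congr (_%:R)%R; congr nat_of_bool.
have E j : (\sum_(i | P i) U_(f i))%MM j = #|[set i | P i && (f i == j)]|.
  rewrite mnm_sumE -sum1dep_card [RHS]big_mkcondr.
  by apply: eq_bigr => i _; rewrite mnm1E; case: eqP.
apply/eqP/forallP => [<- j|h]; first by rewrite nth_mnm_seq E.
by apply/mnmP=> j; rewrite E -nth_mnm_seq; apply/eqP.
Qed.

Lemma mcoeff_sum_prodX (K I : finType) (N : nat) (Q : pred K) (P : pred I)
    (f : K -> I -> 'I_N) (a : 'X_{1..N}) :
  mcoeff a ((\sum_(k | Q k) \prod_(i | P i) 'X_(f k i))%R : {mpoly int[N]}) =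
  (#|[set k | Q k && [forall j, #|[set i | P i && (f k i == j)]| == nth 0 (mnm_seq a) j]]|%:R)%R.
Proof.
rewrite raddf_sum /= -sum1dep_card natr_sum big_mkcondr; apply: eq_bigr => k _.
by rewrite mcoeff_prodX; case: ifP.
Qed.

Lemma is_partE (N : nat) (l : {ffun 'I_N -> 'I_N.+1}) :
  is_part l = (shape_seq l \in parts N N N).
Proof.
rewrite /is_part partsP size_shape_seq eqxx sumn_shape_seq andTb; congr (_ && _).
apply/idP/idP => [h|].
  have {}h (i j : 'I_N) : i <= j -> l j <= l i by move/forallP/(_ i)/forallP/(_ j)/implyP: h.
  rewrite path_min_sorted; last first.
    by apply/allP=> x /mapP[i _ ->]; rewrite /= -ltnS.
  apply/(sortedP 0) => i; rewrite size_shape_seq => hi.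
  rewrite (nth_shape_seq _ (Ordinal hi)) (nth_shape_seq _ (Ordinal (ltnW hi))).
  exact: h.
move/path_sorted => hs; apply/forallP=> i; apply/forallP=> j; apply/implyP=> hij.
rewrite -!nth_shape_seq; apply: (sorted_leq_nth (leT := geq)) => //; rewrite ?inE ?size_shape_seq //.
  by move=> x y z h1 h2; apply: leq_trans h1.
exact: leqnn.
Qed.

(** The symmetry of [kostka] absorbs the reversal of the content in [card_tableaux]. *)
Lemma schur_coef (N : nat) (l : {ffun 'I_N -> 'I_N.+1}) (a : 'X_{1..N}) :
  0 < N -> decreasing l -> mcoeff a (schur l) = ((kostka (shape_seq l) (mnm_seq a))%:R)%R.
Proof.
move=> N0 dl; rewrite mcoeff_sum_prodX; congr (_%:R)%R.
rewrite -(@kostka_perm _ (rev (mnm_seq a))) ?perm_rev //.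
rewrite -(card_tableaux N0 dl) ?size_mnm_seq //; apply: eq_card => t; rewrite inE.
apply/andP/tableauxP => [[ht /forallP h]|[ht _ h]]; split=> //.
  by move=> i _; apply/eqP.
by apply/forallP=> i; apply/eqP/h.
Qed.

(** A content shorter than [#|T|] is read as padded with zeros. *)
Definition col_count (T : finType) (e : rel T) (s : seq nat) : nat :=
  #|[set k : {ffun T -> 'I_#|T|} |
      proper_col e k & [forall j, #|[set v | k v == j]| == nth 0 s j]]|.

Lemma chrom_sym_coef (T : finType) (e : rel T) (a : 'X_{1..#|T|}) :
  mcoeff a (chrom_sym e) = ((col_count e (mnm_seq a))%:R)%R.
Proof. exact: mcoeff_sum_prodX. Qed.

(** Comparing coefficients monomial by monomial turns the polynomial identity into equations between
    natural numbers. *)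
Lemma schur_positiveP (T : finType) (e : rel T) : 0 < #|T| ->
  schur_positive e <->
  exists c : seq nat -> nat, forall s, size s = #|T| ->
    col_count e s = \sum_(u <- parts #|T| #|T| #|T|) c u * kostka u s.
Proof.
move=> T0; set N := #|T|.
have partN u : u \in parts N N N -> xpredT u -> size u = N /\ forall i, nth 0 u i <= N.
  rewrite partsP => /and3P[/eqP su _ /eqP hu] _; split=> // i.
  case: (ltnP i N) => hi; last by rewrite nth_default ?su.
  by rewrite -[leqRHS]hu (sumn_nth (k := N)) ?su // (bigD1 (Ordinal hi)) //= leq_addr.
have dec l : is_part l -> decreasing l.
  by move=> /andP[/forallP h _] i j ij; move/forallP/(_ j)/implyP: (h i); apply.
have key (c : seq nat -> nat) (coef : {ffun 'I_N -> 'I_N.+1} -> nat) (a : 'X_{1..N}) :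
    (forall l, is_part l -> coef l = c (shape_seq l)) ->
    mcoeff a (\sum_(l | is_part l) schur l *+ coef l)%R =
    ((\sum_(u <- parts N N N) c u * kostka u (mnm_seq a))%:R)%R.
  move=> hc; rewrite -(@big_shape_seq _ _ _ N) ?parts_uniq // raddf_sum natr_sum /=.
  apply: eq_big => [l|l hl]; first by rewrite is_partE andbT.
  by rewrite mcoeffMn (schur_coef a T0 (dec _ l hl)) hc // mulnC natrM mulr_natr.
split=> [[coef E]|[c E]].
  exists (fun u => coef (seq_shape N u)) => s sN.
  have sE : s = mnm_seq [multinom nth 0 s (i : 'I_N) | i < N].
    apply: (@eq_from_nth _ 0); rewrite ?size_mnm_seq // sN => i hi.
    by rewrite (nth_mnm_seq _ (Ordinal hi)) mnmE.
  apply/eqP; rewrite -(eqr_nat int) {1}sE -chrom_sym_coef E.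
  rewrite (key (fun u => coef (seq_shape N u))) -?sE //.
  by move=> l _; rewrite shape_seqK.
exists (fun l => c (shape_seq l)); apply/mpolyP=> a.
by rewrite chrom_sym_coef (key c) // E ?size_mnm_seq.
Qed.

Lemma col_count_sumn (T : finType) (e : rel T) (s : seq nat) :
  size s <= #|T| -> 0 < col_count e s -> sumn s = #|T|.
Proof.
move=> sT /card_gt0P[k]; rewrite inE => /andP[_ /forallP h].
rewrite (sumn_nth sT) -[RHS]sum1_card [RHS](partition_big k xpredT) //=.
by apply: eq_bigr => j _; rewrite -(eqP (h j)) -sum1dep_card.
Qed.

(** Renaming the colours by a permutation preserves properness and permutes the content. *)
Lemma col_count_perm (T : finType) (e : rel T) (s t : seq nat) :
  size s = #|T| -> perm_eq s t -> col_count e s = col_count e t.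
Proof.
move=> sT hst; have tT : size t == #|T| by rewrite -(perm_size hst) sT.
have /tuple_permP[p E] : perm_eq s (Tuple tT) by [].
have nE (j : 'I_#|T|) : nth 0 s j = nth 0 t (p j).
  by rewrite E (nth_map j) ?size_enum_ord // nth_ord_enum (tnth_nth 0).
pose f (q : 'S_#|T|) (k : {ffun T -> 'I_#|T|}) : {ffun T -> 'I_#|T|} := [ffun v => q (k v)].
have fP q k : proper_col e (f q k) = proper_col e k.
  apply: eq_forallb => x; apply: eq_forallb => y.
  by rewrite !ffunE (inj_eq perm_inj).
have fS q k j : [set v | f q k v == j] = [set v | k v == (q^-1)%g j].
  by apply/setP=> v; rewrite !inE ffunE (canF_eq (permK q)).
apply: (card_set_bij (f := f p) (g := f p^-1%g)) => k; rewrite !inE fP => /andP[-> /forallP h] /=.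
  split; last by apply/ffunP=> v; rewrite !ffunE permK.
  by apply/forallP=> j; rewrite fS (eqP (h _)) nE permKV.
split; last by apply/ffunP=> v; rewrite !ffunE permKV.
by apply/forallP=> j; rewrite fS invgK (eqP (h _)) nE.
Qed.

Lemma col_count_pad (T : finType) (e : rel T) (s : seq nat) (k : nat) :
  col_count e (s ++ nseq k 0) = col_count e s.
Proof.
apply: eq_card => k'; rewrite !inE; congr (_ && _); apply: eq_forallb => j.
rewrite nth_cat nth_nseq if_same; case: ltnP => // h.
by rewrite (nth_default 0 h).
Qed.

(** Some Schur function with positive coefficient contains the monomial [t]; by [kostka_move] it
    also contains [u], and no term is negative, so nothing cancels. *)
Lemma schur_positive_move (T : finType) (e : rel T) (a b : nat) (s t u : seq nat) :
  schur_positive e -> size t <= #|T| -> b < a ->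
  perm_eq t (a :: b :: s) -> perm_eq u (a.-1 :: b.+1 :: s) ->
  0 < col_count e t -> 0 < col_count e u.
Proof.
move=> he tT ltba ht hu t0.
have su : size u = size t by rewrite (perm_size hu) (perm_size ht).
have T0 : 0 < #|T| by apply: leq_trans tT; rewrite (perm_size ht).
have /(schur_positiveP e T0)[c E] := he.
(* Contents are padded to length [#|T|], the length at which the expansion is available. *)
rewrite -(col_count_pad _ _ (#|T| - size t)) E ?lt0n ?sum_nat_seq_neq0 in t0; last first.
  by rewrite size_cat size_nseq subnKC.
rewrite -(col_count_pad _ _ (#|T| - size t)) E ?lt0n ?sum_nat_seq_neq0; last first.
  by rewrite size_cat size_nseq su subnKC.
case/hasP: t0 => l hl /=; rewrite muln_eq0 negb_or => /andP[hc hK].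
apply/hasP; exists l => //=; rewrite muln_eq0 negb_or hc /=.
move: hK; rewrite -!lt0n (@kostka_perm _ _ (a :: b :: s ++ nseq (#|T| - size t) 0)); last first.
  by rewrite -!cat_cons perm_cat2r.
rewrite (@kostka_perm _ (u ++ _) (a.-1 :: b.+1 :: s ++ nseq (#|T| - size t) 0)).
  exact: kostka_move.
by rewrite -!cat_cons perm_cat2r.
Qed.

(** * Counting fan colourings by words *)

(** Reading the colours along [vs] turns colourings of content [s] into rearrangements of a fixed
    word, which makes the count computable. *)
Lemma col_count_words (T : finType) (e : rel T) (vs : seq T) (P : pred (seq nat)) (s : seq nat) :
  0 < #|T| -> perm_eq vs (enum T) ->
  (forall k : T -> nat, P (map k vs) = [forall x, forall y, e x y ==> (k x != k y)]) ->
  size s <= #|T| -> sumn s = #|T| ->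
  col_count e s =
  count P (permutations (flatten [seq nseq (nth 0 s i) i | i <- iota 0 (size s)])).
Proof.
move=> /card_gt0P[x0 _] hvs hP sT sumT.
have uvs : uniq vs by rewrite (perm_uniq hvs) enum_uniq.
have inv x : x \in vs by rewrite (perm_mem hvs) mem_enum.
have szvs : size vs = #|T| by rewrite (perm_size hvs) -cardE.
set w0 := flatten _.
pose word (k : {ffun T -> 'I_#|T|}) : seq nat := [seq (k v : nat) | v <- vs].
have cw j : count_mem j w0 = nth 0 s j.
  rewrite /w0 count_flatten -map_comp sumnE big_map.
  rewrite (eq_bigr (fun i => (i == j) * nth 0 s i)); last by move=> i _; rewrite /= count_nseq.
  case: (ltnP j (size s)) => hj; last first.
    rewrite nth_default // big1_seq // => i /andP[_]; rewrite mem_iota => hi.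
    by case: eqP => [ij|]; [lia|].
  rewrite (bigD1_seq j) ?iota_uniq ?mem_iota //= eqxx mul1n big1 ?addn0 // => i.
  by case: eqP.
have sw0 : size w0 = #|T|.
  rewrite size_flatten /shape -map_comp -sumT -[s in RHS](mkseq_nth 0).
  by congr sumn; apply: eq_map => i /=; rewrite size_nseq.
have cword k j : count_mem j (word k) = #|[set v | (k v == j :> nat)]|.
  rewrite count_map -size_filter cardE /enum_mem -enumT.
  apply/perm_size/(perm_trans (perm_filter _ hvs)).
  by rewrite -(@eq_filter _ (mem [set v | k v == j :> nat])) // => v; rewrite !inE.
have wordP k : perm_eq (word k) w0 = [forall j, #|[set v | k v == j]| == nth 0 s j].
  apply/idP/forallP => [/seq.permP h j|h].
    by rewrite -cw -h cword.
  apply/allP => /= j _; rewrite cw cword.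
  case: (ltnP j #|T|) => hj; first exact: (h (Ordinal hj)).
  rewrite nth_default ?(leq_trans sT) // cards_eq0; apply/eqP/setP=> v; rewrite !inE.
  by apply/negP=> /eqP E; move: (ltn_ord (k v)); rewrite E ltnNge hj.
have word_inj : injective word.
  move=> k1 k2 /eq_in_map h; apply/ffunP=> v; apply/val_inj/h/inv.
rewrite /col_count -size_filter -sum1_card -big_enum sum1_size /=.
rewrite -(size_map word); apply/perm_size/uniq_perm.
- by rewrite map_inj_uniq ?enum_uniq.
- by rewrite filter_uniq ?permutations_uniq.
move=> w; rewrite mem_filter mem_permutations; apply/mapP/andP => [[k]|[Pw hw]].
  by rewrite mem_enum inE -wordP => /andP[hk pk] ->; rewrite hP.
(* Conversely, a word gives each vertex the letter at its position in [vs]; letters are below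
   [size s], hence admissible colours. *)
have lt v : nth 0 w (index v vs) < #|T|.
  have szw : size w = #|T| by rewrite (perm_size hw).
  have : nth 0 w (index v vs) \in w0.
    by rewrite -(perm_mem hw) mem_nth // szw -szvs index_mem.
  case/flattenP=> _ /mapP[i + ->]; rewrite mem_iota => /andP[_ hi].
  by move/nseqP=> [-> _]; apply: leq_trans sT.
pose k : {ffun T -> 'I_#|T|} := [ffun v => Ordinal (lt v)].
have wk : word k = w.
  apply: (@eq_from_nth _ 0); rewrite size_map.
    by rewrite szvs (perm_size hw).
  by move=> i hi; rewrite (nth_map x0) // ffunE /= index_uniq.
exists k => //; rewrite mem_enum inE -wordP wk hw andbT.
by move: Pw; rewrite -wk hP.
Qed.

(* The first m letters are the colours of the independent vertices, the other
   ones those of the path. *)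
Definition fan_word (m : nat) (w : seq nat) : bool :=
  all (fun i => i \notin drop m w) (take m w) && sorted (fun i j => i != j) (drop m w).

Definition fan_count (m : nat) (s : seq nat) : nat :=
  count (fan_word m) (permutations (flatten [seq nseq (nth 0 s i) i | i <- iota 0 (size s)])).

Lemma card_fan (m n : nat) : #|{: 'I_m + 'I_n}| = m + n.
Proof. by rewrite card_sum !card_ord. Qed.

(** Listing the independent vertices first and then the path in order translates properness into
    [fan_word]. *)
Lemma col_count_fan (m n : nat) (s : seq nat) : 0 < m -> size s <= m + n -> sumn s = m + n ->
  col_count (fan_rel m n) s = fan_count m s.
Proof.
move=> m0; rewrite -card_fan => h1 h2.
apply: (col_count_words (vs := map inl (enum 'I_m) ++ map inr (enum 'I_n))) => //.
- by rewrite card_fan addn_gt0 m0.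
- apply: uniq_perm; rewrite ?enum_uniq //.
    rewrite cat_uniq !map_inj_uniq ?enum_uniq //; try by move=> x y [].
    rewrite -!enumT !enum_uniq andbT /=.
    by apply/hasPn=> _ /mapP[i _ ->]; apply/mapP=> -[].
  move=> v; rewrite [RHS]mem_enum; apply/idP; rewrite mem_cat.
  by case: v => i; apply/orP; [left|right]; rewrite map_f ?mem_enum.
move=> k; rewrite /fan_word map_cat -(map_comp k inl) -(map_comp k inr).
rewrite drop_size_cat ?take_size_cat ?size_map -?enumT ?size_enum_ord //.
apply/andP/forallP => [[/allP hI /(sortedP 0) hP]|h].
  have adj (i j : 'I_n) : i.+1 == j -> k (inr i) != k (inr j).
    move=> /eqP ij; have := hP i; rewrite size_map size_enum_ord ij ltn_ord => /(_ isT).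
    by rewrite !(nth_map i 0) ?size_enum_ord ?ltn_ord // !nth_ord_enum.
  have joint i j : k (inl i) != k (inr j).
    have /hI : k (inl i) \in map (k \o inl) (enum 'I_m) by apply: map_f; rewrite mem_enum.
    by apply: contra => /eqP->; apply: (map_f (k \o inr)); rewrite mem_enum.
  move=> x; apply/forallP=> y; apply/implyP.
  case: x y => [i|i] [j|j] //= hij; rewrite ?joint 1?eq_sym ?joint //.
  by case/orP: hij => /adj; rewrite // eq_sym.
split.
  apply/allP=> _ /mapP[i _ ->]; apply/mapP=> -[j _ /eqP].
  by apply/negP; move/forallP/(_ (inr j)): (h (inl i)).
apply/(sortedP 0) => i; rewrite size_map size_enum_ord => hi.
have hi' := ltnW hi.
rewrite !(nth_map (Ordinal hi) 0) ?size_enum_ord //.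
rewrite (nth_ord_enum _ (Ordinal hi)) (nth_ord_enum _ (Ordinal hi')) /=.
by move/forallP/(_ (inr (Ordinal hi)))/implyP: (h (inr (Ordinal hi'))); apply; rewrite /= eqxx.
Qed.

(** * Criteria for positivity and non-positivity that can be checked by computation *)

(** Tables list partitions without zero parts, hence the filter on [u]; an absent partition gets
    coefficient 0. *)
Definition coef_at (tab : seq (seq nat * nat)) (u : seq nat) : nat :=
  sumn [seq p.2 | p <- tab & p.1 == [seq x <- u | 0 < x]].

(** Contents that are partitions suffice: both sides are symmetric in the content and vanish when
    its sum is not [m + n]. *)
Lemma fan_positive (m n : nat) (tab : seq (seq nat * nat)) : 0 < m ->
  (let P := parts (m + n) (m + n) (m + n) in
   all (fun s => fan_count m s == sumn [seq coef_at tab u * kostka u s | u <- P]) P) ->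
  schur_positive (fan_rel m n).
Proof.
move=> m0 /allP /= h; apply/schur_positiveP; first by rewrite card_fan addn_gt0 m0.
exists (coef_at tab) => s; rewrite card_fan => ss.
case: (sumn s =P m + n) => [sums|sums]; last first.
  rewrite [LHS](_ : _ = 0) ?big1_seq // => [u /andP[_]|].
    rewrite partsP => /and3P[_ _ /eqP hu]; rewrite kostka_sumn ?muln0 // hu.
    exact/eqP.
  apply/eqP; rewrite -leqn0 leqNgt; apply/negP=> /col_count_sumn.
  by rewrite card_fan ss => /(_ (leqnn _)).
have ps : perm_eq s (sort geq s) by rewrite perm_sym perm_sort.
have ssort : size (sort geq s) = m + n by rewrite size_sort.
have sumsort : sumn (sort geq s) = m + n by rewrite -(perm_sumn ps).
have := h (sort geq s); rewrite partsP ssort sumsort !eqxx andbT /= path_min_sorted; last first.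
  apply/allP=> x; rewrite mem_sort => /(nthP 0)[i hi <-].
  rewrite /= -sums (sumn_nth (leqnn _)) (bigD1 (Ordinal hi)) //=.
  exact: leq_addr.
rewrite sort_sorted => [/(_ isT)/eqP|x y]; last exact: leq_total.
rewrite sumnE big_map (col_count_perm _ _ ps) ?card_fan // col_count_fan ?ssort // => ->.
by apply: eq_bigr => u _; rewrite (kostka_perm _ ps).
Qed.

(* The witness is the functional summing the coefficients at the contents in A
   minus those at the contents in B. *)
Lemma fan_not_positive (m n : nat) (A B : seq (seq nat)) : 0 < m ->
  all (fun s => (size s == m + n) && (sumn s == m + n)) (A ++ B) ->
  all (fun u => sumn [seq kostka u s | s <- B] <= sumn [seq kostka u s | s <- A])
    (parts (m + n) (m + n) (m + n)) ->
  sumn [seq fan_count m s | s <- A] < sumn [seq fan_count m s | s <- B] ->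
  ~ schur_positive (fan_rel m n).
Proof.
move=> m0 /allP hAB /allP hle hlt /schur_positiveP[|c]; first by rewrite card_fan addn_gt0 m0.
rewrite card_fan => E.
have sumE S : {subset S <= A ++ B} -> sumn [seq fan_count m s | s <- S] =
    \sum_(u <- parts (m + n) (m + n) (m + n)) c u * sumn [seq kostka u s | s <- S].
  move=> hS; rewrite sumnE big_map (eq_big_seq (fun s =>
    \sum_(u <- parts (m + n) (m + n) (m + n)) c u * kostka u s)) => [|s /hS /hAB].
    rewrite exchange_big; apply: eq_bigr => u _.
    by rewrite sumnE big_map big_distrr.
  by case/andP=> /eqP ss /eqP sums; rewrite -E // col_count_fan ?ss.
move: hlt; rewrite ltnNge !sumE => [|s hs|s hs]; try by rewrite mem_cat hs ?orbT.
case/negP; rewrite big_seq [leqRHS]big_seq; apply: leq_sum => u /hle.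
by rewrite leq_mul2l orbC => ->.
Qed.

(** * Contents of proper colourings of a fan *)

Lemma card_color (m n : nat) (C : eqType) (k : 'I_m + 'I_n -> C) (j : C) :
  #|[set v | k v == j]| = \sum_(i < m) (k (inl i) == j) + \sum_(i < n) (k (inr i) == j).
Proof. by rewrite -sum1dep_card big_mkcond big_sumType. Qed.

Lemma sum_odd (n : nat) : \sum_(i < n) odd i = n./2.
Proof.
elim: n => [|n IH]; first by rewrite big_ord0.
by rewrite big_ord_recr /= IH uphalf_half addnC.
Qed.

Lemma sum_even (n : nat) : \sum_(i < n) ~~ odd i = uphalf n.
Proof.
elim: n => [|n IH]; first by rewrite big_ord0.
by rewrite big_ord_recr /= IH uphalf_half; case: (odd n); rewrite /= ?addn0 ?addn1.
Qed.

Lemma fan_proper (m n N : nat) (k : {ffun 'I_m + 'I_n -> 'I_N}) :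
  proper_col (fan_rel m n) k ->
  (forall i j, k (inl i) != k (inr j)) /\
  (forall i j : 'I_n, i.+1 = j -> k (inr i) != k (inr j)).
Proof.
move=> /forallP h; split=> [i j|i j ij].
  by move/forallP/(_ (inr j))/implyP: (h (inl i)); apply.
by move/forallP/(_ (inr j))/implyP: (h (inr i)); apply; rewrite /= ij eqxx.
Qed.

(** The colouring gives 0 to the independent vertices and alternates 1 and 2 along the path; three
    vertices ensure that three colours are available. *)
Lemma fan_col_gt0 (m n : nat) : 0 < m -> 0 < n -> 3 <= m + n ->
  0 < col_count (fan_rel m n) [:: m; uphalf n; n./2].
Proof.
move=> m0 n0 mn.
pose col (v : 'I_m + 'I_n) : nat := if v is inr j then (odd j).+1 else 0.
have lt v : col v < #|{: 'I_m + 'I_n}|.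
  by rewrite card_fan; apply: leq_trans mn; case: v => //= j; case: odd.
apply/card_gt0P; exists [ffun v => Ordinal (lt v)]; rewrite inE; apply/andP; split.
  apply/forallP=> -[i|i]; apply/forallP=> -[j|j]; apply/implyP=> //= hij; rewrite !ffunE -val_eqE //=.
  by case/orP: hij => /eqP <- /=; case: odd.
apply/forallP=> j; rewrite card_color.
rewrite (eq_bigr (fun=> (0 == j :> nat) : nat)) => [|i _]; last by rewrite ffunE -val_eqE.
rewrite [X in _ + X](eq_bigr (fun i : 'I_n => ((odd i).+1 == j :> nat) : nat)) => [|i _]; last first.
  by rewrite ffunE -val_eqE.
rewrite sum_nat_const card_ord.
case: (j : nat) => [|[|[|p]]] /=.
- by rewrite big1 // muln1 addn0.
- rewrite muln0 add0n -sum_even; apply/eqP/eq_bigr => i _.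
  by case: odd.
- rewrite muln0 add0n -sum_odd; apply/eqP/eq_bigr => i _.
  by case: odd.
by rewrite nth_nil muln0 big1 // => i _; case: odd.
Qed.

(** The distinct [a], [b], [c], [d] exhaust the four colours. *)
Lemma two_of_four (N : nat) (a b c d x : 'I_N) :
  a < 4 -> b < 4 -> c < 4 -> d < 4 -> x < 4 -> a != b -> c != d ->
  a != c -> b != c -> a != d -> b != d -> a != x -> b != x -> x = c \/ x = d.
Proof.
have E (y z : 'I_N) : y != z -> y <> z :> nat by move=> /eqP h /val_inj.
move=> ha hb hc hd hx /E h1 /E h2 /E h3 /E h4 /E h5 /E h6 /E h7 /E h8.
case: (x =P c :> nat) => [/val_inj|h9]; first by left.
by right; apply/val_inj => /=; lia.
Qed.

(* If the independent vertices are not a colour class, they use two of the four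
   colours, so that the path is 2-coloured. *)
Lemma fan_content (m n : nat) (s : seq nat) : 0 < m -> 1 < n -> size s <= 4 ->
  0 < col_count (fan_rel m n) s ->
  (exists i, nth 0 s i = m) \/
  (exists i j, [/\ i != j, nth 0 s i = uphalf n & nth 0 s j = n./2]).
Proof.
move=> m0 n1 s4 /card_gt0P[k]; rewrite inE => /andP[/fan_proper[hj hp] /forallP hs].
(* A colour in use has a nonzero entry in [s], hence an index below [size s]. *)
have lt4 v : k v < 4.
  apply: leq_trans s4; rewrite ltnNge; apply/negP=> h.
  have := hs (k v); rewrite nth_default // cards_eq0 => /eqP/setP/(_ v).
  by rewrite !inE eqxx.
pose a := k (inl (Ordinal m0)).
(* If all independent vertices share the colour [a], the join keeps it off the path and its class
   has size [m]. *)
have [/forallP ha|/forallPn[i1 hb]] := boolP [forall i, k (inl i) == a].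
  left; exists a; rewrite -(eqP (hs a)) card_color.
  rewrite (eq_bigr (fun=> 1)) => [|i _]; last by rewrite ha.
  by rewrite sum_nat_const card_ord muln1 big1 ?addn0 // => i _; rewrite eq_sym (negPf (hj _ _)).
right; pose b := k (inl i1).
pose c := k (inr (Ordinal (ltnW n1))); pose d := k (inr (Ordinal n1)).
have cd : c != d by apply: hp.
(* The path avoids [a] and [b], which leaves [c] and [d]; consecutive vertices differ, so these
   alternate. *)
have path_col (i : 'I_n) : k (inr i) = if odd i then d else c.
  have cases (j : 'I_n) : k (inr j) = c \/ k (inr j) = d.
    apply: (@two_of_four _ a b); rewrite ?lt4 //; try exact: hj.
    by rewrite eq_sym.
  case: i => i hi; elim: i hi => [|i IH] hi; first by congr (k (inr _)); apply/val_inj.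
  have := hp (Ordinal (ltnW hi)) (Ordinal hi) erefl; rewrite IH /=.
  by case: (cases (Ordinal hi)) => ->; case: odd; rewrite ?eqxx.
have count_path (x : 'I_#|{: 'I_m + 'I_n}|) (i : 'I_n) : x = k (inr i) ->
    nth 0 s x = \sum_(j < n) ((if odd j then d else c) == x).
  move=> xE; rewrite -(eqP (hs x)) card_color big1 => [|j _]; last first.
    by rewrite xE (negPf (hj _ _)).
  by apply: eq_bigr => j _; rewrite path_col.
exists (val c), (val d); split; first by rewrite val_eqE.
  rewrite (count_path c _ erefl) -sum_even; apply: eq_bigr => j _.
  by case: odd; rewrite ?eqxx // eq_sym (negPf cd).
rewrite (count_path d _ erefl) -sum_odd; apply: eq_bigr => j _.
by case: odd; rewrite ?eqxx // (negPf cd).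
Qed.

(** * Computations for individual fans *)

(** The Schur expansions of the eleven positive fans, certified by [fan_check_small]. *)
Definition fan_table (m n : nat) : seq (seq nat * nat) :=
  match m, n with
  | 1, 1 => [:: ([:: 1; 1], 2)]
  | 1, 2 => [:: ([:: 1; 1; 1], 6)]
  | 1, 3 => [:: ([:: 2; 1; 1], 2); ([:: 1; 1; 1; 1], 18)]
  | 1, 4 => [:: ([:: 2; 2; 1], 2); ([:: 2; 1; 1; 1], 14); ([:: 1; 1; 1; 1; 1], 54)]
  | 2, 1 => [:: ([:: 2; 1], 1); ([:: 1; 1; 1], 4)]
  | 2, 2 => [:: ([:: 2; 1; 1], 2); ([:: 1; 1; 1; 1], 18)]
  | 2, 3 => [:: ([:: 2; 2; 1], 2); ([:: 2; 1; 1; 1], 8); ([:: 1; 1; 1; 1; 1], 78)]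
  | 2, 4 => [:: ([:: 2; 2; 2], 6); ([:: 2; 2; 1; 1], 10); ([:: 2; 1; 1; 1; 1], 54);
       ([:: 1; 1; 1; 1; 1; 1], 330)]
  | 2, 5 => [:: ([:: 3; 2; 2], 2); ([:: 3; 2; 1; 1], 2); ([:: 3; 1; 1; 1; 1], 14);
       ([:: 2; 2; 2; 1], 26); ([:: 2; 2; 1; 1; 1], 56);
       ([:: 2; 1; 1; 1; 1; 1], 366); ([:: 1; 1; 1; 1; 1; 1; 1], 1374)]
  | 2, 6 => [:: ([:: 3; 3; 2], 2); ([:: 3; 3; 1; 1], 2); ([:: 3; 2; 2; 1], 14);
       ([:: 3; 2; 1; 1; 1], 44); ([:: 3; 1; 1; 1; 1; 1], 212);
       ([:: 2; 2; 2; 2], 68); ([:: 2; 2; 2; 1; 1], 50);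
       ([:: 2; 2; 1; 1; 1; 1], 410); ([:: 2; 1; 1; 1; 1; 1; 1], 2238);
       ([:: 1; 1; 1; 1; 1; 1; 1; 1], 5658)]
  | 3, 4 => [:: ([:: 3; 2; 2], 2); ([:: 3; 2; 1; 1], 4); ([:: 3; 1; 1; 1; 1], 8);
       ([:: 2; 2; 2; 1], 4); ([:: 2; 2; 1; 1; 1], 70); ([:: 2; 1; 1; 1; 1; 1], 300);
       ([:: 1; 1; 1; 1; 1; 1; 1], 1902)]
  | _, _ => [::]
  end.

Definition fan_check (m n : nat) : bool :=
  let P := parts (m + n) (m + n) (m + n) in
  all (fun s => fan_count m s == sumn [seq coef_at (fan_table m n) u * kostka u s | u <- P]) P.

Lemma fan_check_small :
  all (fan_check 1) [:: 1; 2; 3; 4] && all (fan_check 2) [:: 1; 2; 3; 4; 5; 6] && fan_check 3 4.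
Proof. by vm_compute. Qed.

Lemma fan_36_not_positive : ~ schur_positive (fan_rel 3 6).
Proof.
(* Listing (3,3,2,1) twice gives it weight 2. By [fan_content], (4,2,2,1) is the content of no
   proper colouring, so it adds to the functional on Schur functions but not on X_G. *)
by apply: (@fan_not_positive 3 6
  [:: [:: 3; 3; 3; 0; 0; 0; 0; 0; 0]; [:: 3; 2; 2; 2; 0; 0; 0; 0; 0];
      [:: 4; 2; 2; 1; 0; 0; 0; 0; 0]]
  [:: [:: 3; 3; 2; 1; 0; 0; 0; 0; 0]; [:: 3; 3; 2; 1; 0; 0; 0; 0; 0]]); vm_compute.
Qed.

Lemma fan_46_not_positive : ~ schur_positive (fan_rel 4 6).
Proof.
(* Here (5,2,2,1) and (4,4,1,1) are contents of no proper colouring: a path on six vertices has no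
   independent set of size 4. *)
by apply: (@fan_not_positive 4 6
  [:: [:: 4; 3; 3; 0; 0; 0; 0; 0; 0; 0]; [:: 3; 3; 2; 2; 0; 0; 0; 0; 0; 0];
      [:: 4; 4; 1; 1; 0; 0; 0; 0; 0; 0]; [:: 5; 2; 2; 1; 0; 0; 0; 0; 0; 0]]
  [:: [:: 3; 3; 3; 1; 0; 0; 0; 0; 0; 0]; [:: 4; 2; 2; 2; 0; 0; 0; 0; 0; 0]]); vm_compute.
Qed.

Lemma fan_38_not_positive : ~ schur_positive (fan_rel 3 8).
Proof.
(* Here (5,2,2,2) is the content of no proper colouring. *)
by apply: (@fan_not_positive 3 8
  [:: [:: 4; 4; 3; 0; 0; 0; 0; 0; 0; 0; 0]; [:: 4; 3; 2; 2; 0; 0; 0; 0; 0; 0; 0];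
      [:: 5; 2; 2; 2; 0; 0; 0; 0; 0; 0; 0]]
  [:: [:: 4; 4; 2; 1; 0; 0; 0; 0; 0; 0; 0]; [:: 4; 3; 3; 1; 0; 0; 0; 0; 0; 0; 0]]); vm_compute.
Qed.

(** * Excluding the remaining pairs by moves *)

Lemma fan_col_move (m n : nat) (t : seq nat) (a b c d : nat) :
  schur_positive (fan_rel m n) -> 4 <= m + n -> 0 < col_count (fan_rel m n) t ->
  perm_eq t [:: a; b; c; d] -> b < a ->
  0 < col_count (fan_rel m n) [:: a.-1; b.+1; c; d].
Proof.
move=> he mn t0 ht ltba; apply: (schur_positive_move he _ ltba ht) => //.
by rewrite card_fan (perm_size ht).
Qed.

(** A boolean form of [fan_content] that [lia] can refute. The sizes involved are positive, which
    excludes indices past the end, where [nth] returns 0. *)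
Lemma fan_content4 (m n x y z w : nat) : 0 < m -> 1 < n ->
  0 < col_count (fan_rel m n) [:: x; y; z; w] ->
  [|| m \in [:: x; y; z; w],
      (uphalf n == x) && (n./2 \in [:: y; z; w]),
      (uphalf n == y) && (n./2 \in [:: x; z; w]),
      (uphalf n == z) && (n./2 \in [:: x; y; w]) |
      (uphalf n == w) && (n./2 \in [:: x; y; z])].
Proof.
move=> m0 n1 /(@fan_content m n [:: x; y; z; w] m0 n1 isT); rewrite !inE.
have f0 : 0 < n./2 by lia.
have c0 : 0 < uphalf n by lia.
case=> [[i hi]|[i [j [ij hi hj]]]].
  move: i hi => [|[|[|[|i]]]] /=; rewrite ?nth_nil => hi; last by rewrite -hi in m0.
  - by rewrite hi eqxx.
  - by rewrite hi eqxx orbT.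
  - by rewrite hi eqxx !orbT.
  by rewrite hi eqxx !orbT.
have small k v : nth 0 [:: x; y; z; w] k = v -> 0 < v -> k < 4.
  by move=> <-; case: (ltnP k 4) => // h; rewrite nth_default.
have i4 := small i _ hi c0; have j4 := small j _ hj f0; rewrite -hi -hj {hi hj small}.
by move: i j i4 j4 ij => [|[|[|[|i]]]] [|[|[|[|j]]]] //= _ _ _; rewrite !eqxx !orbT.
Qed.

(** The only path vertex is adjacent to all others, so it is alone in its colour class. *)
Lemma fan_content1 (m : nat) (s : seq nat) : 0 < col_count (fan_rel m 1) s -> 1 \in s.
Proof.
case/card_gt0P=> k; rewrite inE => /andP[/fan_proper[hj _] /forallP hs].
have E : nth 0 s (k (inr ord0)) = 1.
  rewrite -(eqP (hs _)) card_color big_ord1 eqxx big1 // => i _.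
  by rewrite (negPf (hj _ _)).
by rewrite -E mem_nth // ltnNge; apply/negP=> h; rewrite nth_default in E.
Qed.

Ltac perm_lia := apply/seq.permP => p /=; lia.

Lemma fan_necessary (m n : nat) : 0 < m -> 0 < n -> schur_positive (fan_rel m n) ->
  [|| (m == 1) && (n <= 4), (m == 2) && (n <= 6) | (m == 3) && (n == 4)] \/
  (m, n) \in [:: (3, 6); (4, 6); (3, 8)].
Proof.
move=> m0 n0 he; rewrite !inE !xpair_eqE.
case: (leqP (m + n) 3) => mn; first by left; lia.
have start : 0 < col_count (fan_rel m n) [:: m; uphalf n; n./2; 0].
  by rewrite (col_count_pad _ [:: m; uphalf n; n./2] 1) fan_col_gt0 // ltnW.
have mv := fun t a b c d => @fan_col_move m n t a b c d he mn.
have [n1|n1] := leqP n 1.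
  have En : n = 1 by lia.
  (* A star with at least three leaves: (m,1) moves to (m-1,2), which has no class of size 1. *)
  exfalso; have m1 : 1 < m by lia.
  move: mv start; rewrite {}En => mv start.
  have /fan_content1 := mv _ m 1 0 0 start (perm_refl _) m1.
  by rewrite !inE; lia.
have := @fan_content4 m n _ _ _ _ m0 n1.
have cf : uphalf n + n./2 = n by lia.
have : n./2 <= uphalf n <= n./2.+1 by lia.
move: (uphalf n) (n./2) cf start => c f cf start hcf block.
(* When [m] is at least [f + 2], one move from the class of size [m] to a path class of size [f]
   leaves neither a part [m] nor two parts [c], [f]. *)
case: (leqP f.+2 m) => [mf|mf].
  have [E|E] : c = f \/ c = f.+1 by lia.
    have /block : 0 < col_count (fan_rel m n) [:: m.-1; c.+1; f; 0].
      by apply: mv start (perm_refl _) _; lia.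
    by rewrite !inE; lia.
  have /block : 0 < col_count (fan_rel m n) [:: m.-1; f.+1; c; 0].
    by apply: mv start _ _; [perm_lia|lia].
  by rewrite !inE; lia.
(* Symmetrically, a large path class of size [c] gives a vertex to the class of size [m]. *)
case: (leqP m.+2 c) => [mc|mc].
  have /block : 0 < col_count (fan_rel m n) [:: c.-1; m.+1; f; 0].
    by apply: mv start _ _; [perm_lia|lia].
  by rewrite !inE; lia.
(* Otherwise m, c and f are nearly equal and a fourth colour takes over some of
   their vertices; this needs n to be large enough. *)
have [E|E] : c = f \/ c = f.+1 by lia.
  have [Em|Em] : c <= m \/ m.+1 = c by lia.
    (* For [c < 4] the pair is listed; (3,6) and (4,6) occur at [c = 3]. Otherwise all three classes
       give one vertex to the fourth, whose size 3 is below both [c] and [m]. *)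
    case: (ltnP c 4) => c4; first by lia.
    have s1 : 0 < col_count (fan_rel m n) [:: c.-1; 1; m; f].
      by apply: mv start _ _; [perm_lia|lia].
    have s2 : 0 < col_count (fan_rel m n) [:: m.-1; 2; c.-1; f].
      by apply: mv s1 _ _; [perm_lia|lia].
    have /block : 0 < col_count (fan_rel m n) [:: f.-1; 3; m.-1; c.-1].
      by apply: mv s2 _ _; [perm_lia|lia].
    by rewrite !inE; lia.
  (* At [c = 4] this is (3,8). From [c = 5] on, one path class gives two vertices and the class of
     size [m] one; then 3 differs from [m = c - 1]. *)
  case: (ltnP c 5) => c5; first by lia.
  have s1 : 0 < col_count (fan_rel m n) [:: c.-1; 1; m; f].
    by apply: mv start _ _; [perm_lia|lia].
  have s2 : 0 < col_count (fan_rel m n) [:: c.-2; 2; m; f].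
    by apply: mv s1 _ _; [perm_lia|lia].
  have /block : 0 < col_count (fan_rel m n) [:: m.-1; 3; c.-2; f].
    by apply: mv s2 _ _; [perm_lia|lia].
  by rewrite !inE; lia.
have [Em|Em] : m = f \/ m = f.+1 by lia.
  (* The target is (f-1, 2, f-1, f+1), which has no part [f = m] once [f] is at least 3. *)
  case: (ltnP f 3) => f3; first by lia.
  have s1 : 0 < col_count (fan_rel m n) [:: m.-1; 1; c; f].
    by apply: mv start _ _; [perm_lia|lia].
  have /block : 0 < col_count (fan_rel m n) [:: f.-1; 2; m.-1; c].
    by apply: mv s1 _ _; [perm_lia|lia].
  by rewrite !inE; lia.
(* The target is (f, 2, f, f), which has no part [f + 1 = m = c] once [f] is at least 2. *)
case: (ltnP f 2) => f2; first by lia.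
have s1 : 0 < col_count (fan_rel m n) [:: m.-1; 1; c; f].
  by apply: mv start _ _; [perm_lia|lia].
have /block : 0 < col_count (fan_rel m n) [:: c.-1; 2; m.-1; f].
  by apply: mv s1 _ _; [perm_lia|lia].
by rewrite !inE; lia.
Qed.

Theorem theorem3p6 (m n : nat) : (0 < m)%N -> (0 < n)%N ->
  (schur_positive (fan_rel m n) <->
   [|| (m == 1) && (n <= 4), (m == 2) && (n <= 6) | (m == 3) && (n == 4)]%N).
Proof.
move=> m0 n0; split=> [he|h].
  case: (fan_necessary m0 n0 he) => //; rewrite !inE => /or3P[] /eqP[Em En].
  - by subst m n; case: (fan_36_not_positive he).
  - by subst m n; case: (fan_46_not_positive he).
  by subst m n; case: (fan_38_not_positive he).
apply: (@fan_positive m n (fan_table m n) m0); rewrite -/(fan_check m n).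
have /andP[/andP[/allP h1 /allP h2] h3] := fan_check_small.
case/or3P: h => /andP[/eqP-> hn]; last by rewrite (eqP hn).
  by apply: h1; rewrite !inE; lia.
by apply: h2; rewrite !inE; lia.
Qed.
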